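(* Every finite algebra of finite type which has a compatible semilattice term operation is finitely based.
   Context: An algebra is of finite type if it has finitely many basic operations. A compatible semilattice term operation of an algebra $\mathbf{A}$ is a binary term operation $\wedge$ of $\mathbf{A}$ which is idempotent, commutative, associative, and is a homomorphism $\wedge:\mathbf{A}^2\to\mathbf{A}$. An algebra is finitely based if its set of valid equations (identities) is axiomatized by finitely many equations. *)

(* Defs.v *)
From mathcomp Require Import all_boot.

Set Implicit Arguments.
Unset Strict Implicit.
Unset Printing Implicit Defensive.

Record signature := Signature {
  symbol :> Type;
  arity : symbol -> nat
}.

(* [T ^ n] is [{ffun 'I_n -> T}], the type of n-tuples over [T]. An algebra
   may be empty; an empty one vacuously satisfies every equation. *)
Record algebra (S : signature) := Algebra {
  carrier :> Type;
  op : forall f : S, (carrier ^ arity f)%type -> carrier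
}.

Definition is_hom (S : signature) (A B : algebra S) (h : A -> B) : Prop :=
  forall (f : S) (x : (A ^ arity f)%type), h (op x) = op [ffun i => h (x i)].

Definition prod_algebra (S : signature) (A B : algebra S) : algebra S :=
  @Algebra S (A * B)%type (fun (f : S) (x : ((A * B) ^ arity f)%type) =>
    (op [ffun i => (x i).1], op [ffun i => (x i).2])).

Inductive term (S : signature) (X : Type) : Type :=
| Var of X
| App (f : S) of (term S X ^ arity f)%type.

Fixpoint eval (S : signature) (A : algebra S) (X : Type) (v : X -> A)
    (t : term S X) {struct t} : A :=
  match t with
  | Var x => v x
  | App f ts => op [ffun i => eval v (ts i)]
  end.

Definition is_binary_term_operation (S : signature) (A : algebra S)
    (m : A -> A -> A) : Prop :=
  exists t : term S 'I_2,
    forall x y : A, m x y = eval (fun i => if i == ord0 then x else y) t.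

Definition is_compatible_semilattice_term_operation (S : signature)
    (A : algebra S) (m : A -> A -> A) : Prop :=
  [/\ is_binary_term_operation m,
      idempotent_op m, commutative m, associative m
    & @is_hom S (prod_algebra A A) A (fun p => m p.1 p.2)].

Definition equation (S : signature) : Type := (term S nat * term S nat)%type.

Definition satisfies (S : signature) (A : algebra S) (e : equation S) : Prop :=
  forall v : nat -> A, eval v e.1 = eval v e.2.

Definition finitely_based (S : signature) (A : algebra S) : Prop :=
  exists (n : nat) (Sigma : 'I_n -> equation S),
    forall e : equation S,
      satisfies A e <->
      (forall B : algebra S, (forall i, satisfies B (Sigma i)) -> satisfies B e).

(* Main.v *)
Require Import Defs.
From mathcomp Require Import all_boot.
From Stdlib Require Import Classical_Prop.

Set Implicit Arguments.
Unset Strict Implicit.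
Unset Printing Implicit Defensive.

(** Because every basic operation commutes with the meet of [A], every term
    operation [t : A ^ X -> A] is a homomorphism of meet semilattices. So, for
    [a : A], the set of assignments [y] with [a <= t y] is a filter of [A ^ X];
    if nonempty it is principal, hence a product of principal filters of [A],
    one for each variable. Let the profile of a variable [x] be the set of pairs
    [(a, y x)] with [a <= t y]. If two variables have the same profile, they
    face the same constraints, and both can be replaced by their meet without
    changing the value of [t] (lemma [eval_profile_meet]). There are only
    [2 ^ (#|A| ^ 2)] profiles, whatever the number of variables. Since [A] has
    only finitely many term operations in variables indexed by [K], the set of
    all possible profiles, finitely many terms [rep g] are enough to give every
    term the form [rep g (w_k : k in K)], where each [w_k] is a meet of
    variables (lemma [exists_normal_form]).

    The following equations, restricted to those that hold in [A], form a
    finite basis: the semilattice laws; the equations that write a single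
    variable as some [rep g]; the equations that put
    [f (rep g_1, ..., rep g_n)], with disjoint variables in the arguments, into
    normal form; and equations between normal forms in a fixed finite set of
    variables. The first three kinds reduce every term to a normal form, by
    induction on the term ([term_normal_form]). The last kind settles every
    equation between two normal forms, in however many variables
    ([normal_forms_eq]): what matters about a variable is only in which of the
    [2 * #|K|] meets it occurs, so the variables that occur in the same meets can
    be replaced by their meet, as if they were a single variable. *)

(** * Terms and substitution *)

(** The induction principle that gives the hypothesis for all arguments of an
    operation symbol. *)
Lemma term_induction (S : signature) (X : Type) (P : term S X -> Prop) :
  (forall x, P (Var S x)) ->
  (forall (f : S) (ts : (term S X ^ arity f)%type),
     (forall i, P (ts i)) -> P (App ts)) ->
  forall t, P t.
Proof.
move=> PVar PApp; fix IH 1; case=> [x|f ts]; first exact: PVar.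
by apply: PApp => i; apply: IH.
Qed.

(** The term [t] with the term [w x] put for each variable [x]. *)
Fixpoint subst (S : signature) (X Y : Type) (w : X -> term S Y)
    (t : term S X) {struct t} : term S Y :=
  match t with
  | Var x => w x
  | App f ts => App [ffun i => subst w (ts i)]
  end.

(** The term [t] with the variable [h x] put for each variable [x]. *)
Definition rename (S : signature) (X Y : Type) (h : X -> Y) :
    term S X -> term S Y :=
  subst (fun x => Var S (h x)).

Lemma eq_eval (S : signature) (C : algebra S) (X : Type) (v v' : X -> C) :
  v =1 v' -> eval v =1 eval v'.
Proof.
move=> vv' t; elim/term_induction: t => [x|f ts IH] /=; first exact: vv'.
by congr (op _); apply/ffunP=> i; rewrite !ffunE IH.
Qed.

Lemma eval_subst (S : signature) (C : algebra S) (X Y : Type)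
    (w : X -> term S Y) (v : Y -> C) (t : term S X) :
  eval v (subst w t) = eval (fun x => eval v (w x)) t.
Proof.
elim/term_induction: t => [//|f ts IH] /=.
by congr (op _); apply/ffunP=> i; rewrite !ffunE IH.
Qed.

Lemma eval_rename (S : signature) (C : algebra S) (X Y : Type)
    (h : X -> Y) (v : Y -> C) (t : term S X) :
  eval v (rename h t) = eval (v \o h) t.
Proof. by rewrite eval_subst. Qed.

(** * Finite meets in a semilattice *)

Definition semilattice (T : Type) (m : T -> T -> T) : Prop :=
  [/\ idempotent_op m, commutative m & associative m].

(** The order of a meet semilattice. *)
Definition below (T : Type) (m : T -> T -> T) (a b : T) : Prop := m a b = a.

(** The meet of the family [h] over a nonempty list of indices, given as its
    head and its tail because the semilattice need not have a top element. *)
Definition big_meet (T : Type) (m : T -> T -> T) (I : Type) (h : I -> T)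
    (p : I * seq I) : T :=
  foldr (fun i c => m (h i) c) (h p.1) p.2.

Section Semilattice.

Variables (T : Type) (m : T -> T -> T).
Hypothesis semilattice_m : semilattice m.

Lemma below_refl a : below m a a.
Proof. by case: semilattice_m => mxx _ _; apply: mxx. Qed.

Lemma below_antisym a b : below m a b -> below m b a -> a = b.
Proof. by case: semilattice_m => _ mC _ ab ba; rewrite -ab mC ba. Qed.

Lemma below_meet c a b : below m c (m a b) <-> below m c a /\ below m c b.
Proof.
case: semilattice_m => mxx mC mA; rewrite /below; split=> [cab|[ca cb]].
  have aba : m (m a b) a = m a b by rewrite mC mA mxx.
  have abb : m (m a b) b = m a b by rewrite -mA mxx.
  by split; rewrite -{1}cab -mA ?aba ?abb.
by rewrite mA ca cb.
Qed.

Lemma below_trans a b c : below m a b -> below m b c -> below m a c.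
Proof. by move=> ab bc; move: ab; rewrite -{1}bc => /below_meet[]. Qed.

Lemma eq_of_below a b : (forall c, below m c a <-> below m c b) -> a = b.
Proof.
by move=> ab; apply: below_antisym; apply/ab; apply: below_refl.
Qed.

Lemma below_foldr (I : eqType) (h : I -> T) b s c :
  below m c (foldr (fun i d => m (h i) d) b s) <->
  below m c b /\ forall i, i \in s -> below m c (h i).
Proof.
elim: s => [|i s IH] /=; first by split=> [|[]].
split=> [/below_meet[ci /IH[cb cs]]|[cb cs]].
  by split=> // j; rewrite inE => /predU1P[->|/cs].
apply/below_meet; split; first by apply: cs; rewrite mem_head.
by apply/IH; split=> // j js; apply: cs; rewrite inE js orbT.
Qed.

Lemma below_big_meet (I : eqType) (h : I -> T) p c :
  below m c (big_meet m h p) <->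
  forall i, i \in p.1 :: p.2 -> below m c (h i).
Proof.
rewrite /big_meet; split=> [/below_foldr[c1 c2] i|cp].
  by rewrite inE => /predU1P[->|/c2].
apply/below_foldr; split=> [|i ip]; apply: cp; first exact: mem_head.
by rewrite inE ip orbT.
Qed.

(** The concatenation of the nonempty lists [D j] for [j] in [p]. *)
Definition flatten_index (I J : Type) (D : J -> I * seq I) (p : J * seq J) :
    I * seq I :=
  ((D p.1).1, (D p.1).2 ++ flatten [seq (D j).1 :: (D j).2 | j <- p.2]).

Lemma big_meet_flatten (I J : eqType) (h : I -> T) (D : J -> I * seq I) p :
  big_meet m (fun j => big_meet m h (D j)) p = big_meet m h (flatten_index D p).
Proof.
apply: eq_of_below => c.
have memE i : (i \in (flatten_index D p).1 :: (flatten_index D p).2) =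
    (i \in flatten [seq (D j).1 :: (D j).2 | j <- p.1 :: p.2]) by [].
split=> /below_big_meet cD; apply/below_big_meet.
  by move=> i; rewrite memE => /flatten_mapP[j /cD/below_big_meet]; apply.
move=> j jp; apply/below_big_meet=> i iD; apply: cD; rewrite memE.
by apply/flatten_mapP; exists j.
Qed.

End Semilattice.

(** * Equations over arbitrary sets of variables *)

(** The validity in [C] of an equation whose variables form any type. *)
Definition valid (S : signature) (C : algebra S) (X : Type)
    (s t : term S X) : Prop :=
  forall v : X -> C, eval v s = eval v t.

(** The equation [s = t] with its variables numbered. *)
Definition encode (S : signature) (X : countType) (s t : term S X) :
    equation S :=
  (rename (@pickle X) s, rename (@pickle X) t).

Lemma satisfies_encode (S : signature) (C : algebra S) (X : countType)
    (s t : term S X) : valid C s t -> satisfies C (encode s t).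
Proof. by move=> st v; rewrite /= !eval_rename. Qed.

(** An element of [C] is needed as the value of the numbers that encode no
    variable. *)
Lemma valid_of_encode (S : signature) (C : algebra S) (X : countType)
    (s t : term S X) : C -> satisfies C (encode s t) -> valid C s t.
Proof.
move=> c0 st v; have := st (fun n => oapp v c0 (unpickle n)).
by rewrite /= !eval_rename !(@eq_eval _ _ _ (_ \o _) v) // => x /=;
  rewrite pickleK.
Qed.

Lemma fin_choice (I : finType) (U : Type) (P : I -> U -> Prop) :
  (forall i, exists u, P i u) -> exists f : I -> U, forall i, P i (f i).
Proof. exact: fin_all_exists. Qed.

(** To find a finite basis, it is enough to give a finite family of equations
    whose members valid in [A] entail all equations valid in [A]. *)
Lemma finitely_based_of_finite_family (S : signature) (A : algebra S)
    (I : finType) (e : I -> equation S) :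
  (forall B : algebra S,
     (forall i, satisfies A (e i) -> satisfies B (e i)) ->
     forall q, satisfies A q -> satisfies B q) ->
  finitely_based A.
Proof.
move=> base_e.
have [e' e'P] : exists e' : I -> equation S, forall i,
    satisfies A (e' i) /\ (satisfies A (e i) -> e' i = e i).
  apply: (fin_choice (P := fun i q =>
    satisfies A q /\ (satisfies A (e i) -> q = e i))) => i.
  have [Ai|nAi] := classic (satisfies A (e i)); first by exists (e i).
  by exists (Var S 0, Var S 0); split.
(* [e'] replaces the equations that fail in [A] by a trivial one. *)
exists #|I|, (fun i => e' (enum_val i)) => q; split=> [Aq B Be'|].
  apply: base_e Aq => i Ai; have := Be' (enum_rank i).
  by rewrite enum_rankK (e'P i).2.
by apply=> i; apply: (e'P _).1.
Qed.

(** A finite algebra has finitely many term operations over a nonempty finite set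
    of variables, and a term can be chosen for each. *)
Lemma exists_representatives (S : signature) (A : finType)
    (opA : forall f : S, (A ^ arity f)%type -> A) (X : finType) (x0 : X) :
  exists rep : {ffun {ffun X -> A} -> A} -> term S X,
    forall t : term S X, exists g, valid (Algebra opA) (rep g) t.
Proof.
pose graph (t : term S X) : {ffun {ffun X -> A} -> A} :=
  [ffun v : {ffun X -> A} => @eval S (Algebra opA) X v t].
have [rep repP] : exists rep : {ffun {ffun X -> A} -> A} -> term S X,
    forall g, (exists t, graph t = g) -> graph (rep g) = g.
  apply: (fin_choice (P := fun g t =>
    (exists t, graph t = g) -> graph t = g)) => g.
  have [[t tg]|no_t] := classic (exists t, graph t = g); first by exists t.
  (* The choice is arbitrary if the operation [g] is given by no term. *)
  by exists (Var S x0) => /no_t.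
exists rep => t; exists (graph t) => v.
have /ffunP/(_ (finfun v)) := repP (graph t) (ex_intro _ t erefl).
by rewrite !ffunE !(@eq_eval _ (Algebra opA) _ _ v) // => x; rewrite ffunE.
Qed.

(** * Meets as terms, and normal forms *)

(** The binary operation that the term [tm] gives on [C]. *)
Definition binop (S : signature) (tm : term S 'I_2) (C : algebra S)
    (x y : C) : C :=
  eval (fun i => if i == ord0 then x else y) tm.

Definition app2 (S : signature) (tm : term S 'I_2) (X : Type)
    (s t : term S X) : term S X :=
  subst (fun i => if i == ord0 then s else t) tm.

Lemma eval_app2 (S : signature) (tm : term S 'I_2) (C : algebra S) (X : Type)
    (v : X -> C) (s t : term S X) :
  eval v (app2 tm s t) = binop tm (eval v s) (eval v t).
Proof. by rewrite eval_subst; apply: eq_eval => i; case: ifP. Qed.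

(** Idempotence, commutativity and associativity of [tm], as equations. *)
Definition semilattice_law (S : signature) (tm : term S 'I_2) (i : 'I_3) :
    equation S :=
  let x := Var S 0 in let y := Var S 1 in let z := Var S 2 in
  if val i is 0 then (app2 tm x x, x)
  else if val i is 1 then (app2 tm x y, app2 tm y x)
  else (app2 tm x (app2 tm y z), app2 tm (app2 tm x y) z).

Lemma semilattice_lawP (S : signature) (tm : term S 'I_2) (C : algebra S) :
  (forall i, satisfies C (semilattice_law tm i)) <->
  semilattice (@binop S tm C).
Proof.
split=> [laws|[mxx mC mA] i v].
  split=> [x|x y|x y z].
  - by have := laws ord0 (fun=> x); rewrite /= eval_app2.
  - have := laws (Ordinal (isT : 1 < 3)) (nth y [:: x; y]).
    by rewrite /= !eval_app2.
  - have := laws (Ordinal (isT : 2 < 3)) (nth z [:: x; y; z]).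
    by rewrite /= !eval_app2.
case: i => [[|[|[|//]]]] lti /=; rewrite !eval_app2 /=.
- exact: mxx.
- exact: mC.
- exact: mA.
Qed.

(** The term for the meet of a nonempty list of variables. *)
Definition meet_term (S : signature) (tm : term S 'I_2) (X : Type)
    (p : X * seq X) : term S X :=
  foldr (fun x t => app2 tm (Var S x) t) (Var S p.1) p.2.

Lemma eval_meet_term (S : signature) (tm : term S 'I_2) (C : algebra S)
    (X : Type) (v : X -> C) (p : X * seq X) :
  eval v (meet_term tm p) = big_meet (@binop S tm C) v p.
Proof.
case: p => x s; rewrite /meet_term /big_meet /=.
by elim: s => [//|y s IH] /=; rewrite eval_app2 IH.
Qed.

(** The term [r] with the meet of the variables in [W k] put for [k]. *)
Definition normal_form (S : signature) (tm : term S 'I_2) (K X : Type)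
    (r : term S K) (W : K -> X * seq X) : term S X :=
  subst (fun k => meet_term tm (W k)) r.

Lemma eval_normal_form (S : signature) (tm : term S 'I_2) (C : algebra S)
    (K X : Type) (v : X -> C) (r : term S K) (W : K -> X * seq X) :
  eval v (normal_form tm r W) =
  eval (fun k => big_meet (@binop S tm C) v (W k)) r.
Proof.
by rewrite eval_subst; apply: eq_eval => k; rewrite eval_meet_term.
Qed.

Lemma eq_eval_normal_form (S : signature) (tm : term S 'I_2) (C : algebra S)
    (K X Y : Type) (v : X -> C) (v' : Y -> C) (r : term S K)
    (W : K -> X * seq X) (W' : K -> Y * seq Y) :
  (forall k, big_meet (@binop S tm C) v (W k) =
             big_meet (@binop S tm C) v' (W' k)) ->
  eval v (normal_form tm r W) = eval v' (normal_form tm r W').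
Proof. by move=> WW'; rewrite !eval_normal_form; apply: eq_eval. Qed.

(** A given element followed by the elements of a finite set, as a nonempty
    list. *)
Definition index_of_set (X : finType) (p : X * {set X}) : X * seq X :=
  (p.1, enum p.2).

(** The set of all possible profiles of a variable, which also serves as the set
    of the variables of the representatives. *)
Definition variable_type (A : finType) : finType := {set A * A}.

(** * Merging variables with equal profiles *)

Section Merging.

Variables (S : signature) (A : finType).
Variable opA : forall f : S, (A ^ arity f)%type -> A.
Let AA : algebra S := Algebra opA.
Variable m : A -> A -> A.
Hypothesis semilattice_m : semilattice m.
Hypothesis m_hom : @is_hom S (prod_algebra AA AA) AA (fun p => m p.1 p.2).

(** Term operations are homomorphisms of semilattices. *)
Lemma eval_meet (X : Type) (v w : X -> A) (t : term S X) :
  @eval S AA X (fun x => m (v x) (w x)) t =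
  m (@eval S AA X v t) (@eval S AA X w t).
Proof.
elim/term_induction: t => [//|f ts IH] /=.
pose vw : ((A * A) ^ arity f)%type :=
  [ffun i => (@eval S AA X v (ts i), @eval S AA X w (ts i))].
have := m_hom vw; rewrite /= => vwE; transitivity (@op S AA f
  [ffun i => (fun p => m p.1 p.2) (vw i)]).
  by apply: congr1; apply/ffunP=> i; rewrite !ffunE IH.
rewrite -[LHS]vwE; apply: congr2; apply: congr1;
  by apply/ffunP=> i; rewrite !ffunE.
Qed.

Lemma eval_foldr_meet (I X : Type) (v : X -> A) (h : I -> X -> A)
    (s : seq I) (t : term S X) :
  @eval S AA X (fun x => foldr (fun i a => m (h i x) a) (v x) s) t =
  foldr (fun i a => m (@eval S AA X (h i) t) a) (@eval S AA X v t) s.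
Proof. by elim: s => [//|i s IH] /=; rewrite eval_meet IH. Qed.

Lemma eval_below (X : Type) (v w : X -> A) (t : term S X) :
  (forall x, below m (v x) (w x)) ->
  below m (@eval S AA X v t) (@eval S AA X w t).
Proof.
move=> vw; rewrite /below -eval_meet.
by apply: (@eq_eval S AA) => x; apply: vw.
Qed.

(** The pairs [(a, c)] such that [a] is below a value of [t] taken at some
    assignment that sends [x] to [c]. *)
Definition profile (X : finType) (t : term S X) (x : X) : variable_type A :=
  [set p : A * A | [exists y : {ffun X -> A},
     (m p.1 (@eval S AA X y t) == p.1) && (y x == p.2)]].

(** Replacing the value of each variable by the meet of the values of the
    variables with the same profile does not change the value of the term. The
    meet is described by its universal property. *)
Lemma eval_profile_meet (X : finType) (t : term S X) (v w : X -> A) :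
  (forall x c, below m c (w x) <->
     (forall y, profile t y = profile t x -> below m c (v y))) ->
  @eval S AA X v t = @eval S AA X w t.
Proof.
move=> wP; apply: (below_antisym semilattice_m); last first.
  apply: eval_below => x.
  by have /wP := below_refl semilattice_m (w x); apply.
set a := @eval S AA X v t.
(* [z] is the least assignment at which the value of [t] is at least [a]. *)
pose s := [seq y : {ffun X -> A} <- enum {: {ffun X -> A}} |
             m a (@eval S AA X y t) == a].
pose z x := foldr (fun (y : {ffun X -> A}) b => m (y x) b) (v x) s.
apply: (@below_trans _ m semilattice_m _ (@eval S AA X z t)).
  rewrite eval_foldr_meet; apply/(below_foldr semilattice_m).
  split=> [|y]; first exact: (below_refl semilattice_m).
  by rewrite mem_filter => /andP[/eqP].
apply: eval_below => x; apply/wP => x' eq_x.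
have : (a, v x') \in profile t x.
  rewrite -eq_x inE; apply/existsP; exists (finfun v); rewrite ffunE eqxx andbT.
  rewrite (@eq_eval S AA X (finfun v) v) => [|i]; last by rewrite ffunE.
  by apply/eqP; apply: (below_refl semilattice_m).
(* As [x] has the same profile, some [y] with [a <= t y] has [y x = v x'], and
   [z] is below [y]. *)
rewrite inE => /existsP[y /andP[ay /eqP yx]] /=.
have /(below_foldr semilattice_m)[_ /(_ y)] :=
  below_refl semilattice_m (z x).
by rewrite /= in yx *; rewrite yx; apply; rewrite mem_filter ay mem_enum.
Qed.

End Merging.

(** * The finite basis *)

Section Basis.

Variables (F : finType) (ar : F -> nat) (A : finType).
Variable opA : forall f : F, (A ^ ar f)%type -> A.
Let S : signature := Signature ar.
Let AA : algebra S := @Algebra S A opA.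
Variable tm : term S 'I_2.
Hypothesis semilattice_A : semilattice (@binop S tm AA).
Hypothesis binop_hom :
  @is_hom S (prod_algebra AA AA) AA (fun p => @binop S tm AA p.1 p.2).
Let K : finType := variable_type A.
(** The operations on [A] in variables indexed by [K]. *)
Let code : finType := {ffun {ffun K -> A} -> A}.
Variable rep : code -> term S K.
Hypothesis repP : forall t : term S K, exists g, valid AA (rep g) t.

(** The normal forms over a finite set of variables, given by finite data. *)
Let finite_nf (X : finType) (g : code) (U : {ffun K -> X * {set X}}) :
    term S X :=
  normal_form tm (rep g) (fun k => index_of_set (U k)).

(** Over a finite nonempty set of variables, every term is equal in [A] to a
    normal form. *)
Lemma exists_normal_form (X : finType) (x0 : X) (t : term S X) :
  exists g (U : {ffun K -> X * {set X}}), valid AA t (finite_nf g U).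
Proof.
pose d := @profile S A opA (@binop S tm AA) X t.
have [g gP] := repP (rename d t).
(* If [k] is the profile of no variable, any value will do. *)
exists g, [ffun k => (odflt x0 [pick x | d x == k], [set x | d x == k])] => v.
rewrite eval_normal_form gP eval_rename.
apply: (eval_profile_meet semilattice_A binop_hom) => x c /=.
rewrite ffunE; split=> [/(below_big_meet semilattice_A) cv y yx|cv].
  by apply: cv; rewrite inE /= mem_enum inE /d yx eqxx orbT.
apply/(below_big_meet semilattice_A) => y.
rewrite inE /= mem_enum inE => /predU1P[->|/eqP]; last exact: cv.
by case: pickP => [z /eqP|/(_ x)]; [apply: cv | rewrite eqxx].
Qed.

(** The variables of [f (rep g_1, ..., rep g_n)]: a copy of [K] for each
    argument, and a variable [None] that the term does not use, so that there is
    a variable even if [f] is a constant. *)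
Let arg_var (f : F) : finType := option ('I_(ar f) * K).

Let app_term (f : F) (g : {ffun 'I_(ar f) -> code}) : term S (arg_var f) :=
  @App S _ f [ffun j => rename (fun k => Some (j, k)) (rep (g j))].

(** A variable that occurs in two given normal forms is classified by the set of
    the [k] at which it occurs in the first and the same set for the second. *)
Let group : finType := ({set K} * {set K})%type.

Let candidate_index : finType :=
  ('I_3 + code +
   {f : F & ({ffun 'I_(ar f) -> code} * code *
             {ffun K -> arg_var f * {set arg_var f}})%type} +
   code * {ffun K -> group * {set group}} *
   (code * {ffun K -> group * {set group}}))%type.

(** The equations whose members valid in [A] form the basis. *)
Let candidate (i : candidate_index) : equation S :=
  match i with
  | inl (inl (inl j)) => semilattice_law tm j
  | inl (inl (inr g)) => encode (rename (fun=> tt) (rep g)) (Var S tt)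
  | inl (inr (existT f (g, h, U))) => encode (app_term g) (finite_nf h U)
  | inr ((g, V), (g', V')) => encode (finite_nf g V) (finite_nf g' V')
  end.

(** The algebras that satisfy the basis. *)
Let model (C : algebra S) : Prop :=
  forall i, satisfies AA (candidate i) -> satisfies C (candidate i).

Lemma model_semilattice (C : algebra S) :
  model C -> semilattice (@binop S tm C).
Proof.
move=> modC; apply/semilattice_lawP => i; apply: (modC (inl (inl (inl i)))).
by move: i; apply/semilattice_lawP.
Qed.

(** Every term is equal to a normal form, and the same one serves for all models
    of the basis. *)
Lemma term_normal_form (t : term S nat) :
  exists g (W : K -> nat * seq nat),
    forall C, model C -> valid C t (normal_form tm (rep g) W).
Proof.
elim/term_induction: t => [x|f ts IH].
  have [g gP] := repP (Var S set0).
  exists g, (fun=> (x, [::])) => C modC v; rewrite eval_normal_form.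
  have : valid C (rename (fun=> tt) (rep g)) (Var S tt).
    apply: (valid_of_encode (v 0)).
    apply: (modC (inl (inl (inr g)))); apply: satisfies_encode => w.
    by rewrite eval_rename gP.
  by move=> /(_ (fun=> v x)); rewrite eval_rename /= => <-.
have [g /fin_choice[W gW]] := fin_choice IH.
pose t : term S (arg_var f) := app_term (finfun g).
have [h [U hU]] := exists_normal_form None t.
pose D (o : arg_var f) := if o is Some jk then W jk.1 jk.2 else (0, [::]).
exists h, (fun k => flatten_index D (index_of_set (U k))) => C modC v.
have semC := model_semilattice modC.
have : valid C t (finite_nf h U).
  apply: (valid_of_encode (v 0)).
  apply: (modC (inl (inr (existT _ f (finfun g, h, U))))).
  exact: satisfies_encode.
move=> /(_ (fun o => big_meet (@binop S tm C) v (D o))).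
rewrite !eval_normal_form => tE; transitivity
  (eval (fun o => big_meet (@binop S tm C) v (D o)) t).
  rewrite /=; apply: congr1; apply/ffunP=> j.
  by rewrite !ffunE (gW j) // eval_rename eval_normal_form.
by rewrite tE; apply: eq_eval => k; apply: (big_meet_flatten semC).
Qed.

(** An equation between normal forms that is valid in [A] is valid in all models
    of the basis. *)
Lemma normal_forms_eq (C : algebra S) (g g' : code)
    (W W' : K -> nat * seq nat) :
  model C ->
  valid AA (normal_form tm (rep g) W) (normal_form tm (rep g') W') ->
  valid C (normal_form tm (rep g) W) (normal_form tm (rep g') W').
Proof.
move=> modC AW v.
have semC := model_semilattice modC.
pose occ (w : nat * seq nat) := w.1 :: w.2.
pose P x : group := ([set k | x \in occ (W k)], [set k | x \in occ (W' k)]).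
pose V (w : nat * seq nat) : group * {set group} :=
  (P w.1, [set q in map P (occ w)]).
have memV w q : q \in (index_of_set (V w)).1 :: (index_of_set (V w)).2 =
    (q \in map P (occ w)).
  by rewrite /= !inE mem_enum inE /= inE orbA orbb.
(* Identifying the variables [x] with the same [P x] gives an equation between
   normal forms over [group], which holds in [A]. *)
have validV : valid C (finite_nf g (finfun (V \o W)))
                      (finite_nf g' (finfun (V \o W'))).
  apply: (valid_of_encode (v 0)).
  apply: (modC (inr ((g, finfun (V \o W)), (g', finfun (V \o W'))))).
  apply: satisfies_encode => u.
  have meetE w : big_meet (@binop S tm AA) u (index_of_set (V w)) =
      big_meet (@binop S tm AA) (u \o P) w.
    apply: (eq_of_below semilattice_A) => c.
    split=> /(below_big_meet semilattice_A) cu;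
      apply/(below_big_meet semilattice_A) => x.
      by move=> xw; apply: cu; rewrite memV map_f.
    by rewrite memV => /mapP[y yw ->]; apply: (cu y).
  have VE (r : code) w : @eval S AA _ u (finite_nf r (finfun (V \o w))) =
      @eval S AA _ (u \o P) (normal_form tm (rep r) w).
    by apply: eq_eval_normal_form => k; rewrite ffunE meetE.
  by rewrite !VE.
(* In [C], the value given to the variable [q : group] is the meet of the values
   of the variables [x] with [P x = q], which have to come from a finite list.
   Where there are none, the default value in [head] makes the meet [v 0], which
   is never used. *)
pose all_vars := flatten [seq occ (W k) ++ occ (W' k) | k : K].
pose u q := let s := [seq x <- all_vars | P x == q] in
  big_meet (@binop S tm C) v (head 0 s, s).
have uP c q x : x \in all_vars -> P x = q -> below (@binop S tm C) c (u q) <->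
    forall y, y \in all_vars -> P y = q -> below (@binop S tm C) c (v y).
  move=> xall xq; rewrite /u (below_big_meet semC) /=.
  have xs : x \in [seq x <- all_vars | P x == q] by rewrite mem_filter xq eqxx.
  have memE y : y \in head 0 [seq x <- all_vars | P x == q] ::
        [seq x <- all_vars | P x == q] = (y \in all_vars) && (P y == q).
    rewrite andbC -(mem_filter (fun z => P z == q)) inE.
    by case: [seq _ <- _ | _] xs => //= z s _; rewrite inE orbA orbb.
  split=> cv y; first by move=> yall /eqP yq; apply: cv; rewrite memE yall.
  by rewrite memE => /andP[yall /eqP]; apply: cv.
have meetE w : (forall x y, x \in occ w -> P x = P y -> y \in occ w) ->
    {subset occ w <= all_vars} ->
    big_meet (@binop S tm C) u (index_of_set (V w)) =
    big_meet (@binop S tm C) v w.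
  move=> wP wall; apply: (eq_of_below semC) => c.
  split=> /(below_big_meet semC) cu; apply/(below_big_meet semC) => x.
    move=> xw; have := cu (P x); rewrite memV map_f // => /(_ isT).
    by rewrite (uP _ _ x) ?wall // => /(_ x); apply; rewrite ?wall.
  rewrite memV => /mapP[y yw ->]; apply/(uP _ _ y) => //; first exact: wall.
  by move=> z _ zy; apply: cu; apply: wP (esym zy).
(* The sets of variables in [W k] and in [W' k] are unions of classes of [P]. *)
have WE k : big_meet (@binop S tm C) v (W k) =
    big_meet (@binop S tm C) u (index_of_set (finfun (V \o W) k)).
  rewrite ffunE meetE // => [x y xW [/setP/(_ k)]|x xW].
    by rewrite !in_set xW => <-.
  by apply/flatten_mapP; exists k; rewrite ?mem_enum // mem_cat xW.
have W'E k : big_meet (@binop S tm C) v (W' k) =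
    big_meet (@binop S tm C) u (index_of_set (finfun (V \o W') k)).
  rewrite ffunE meetE // => [x y xW [_ /setP/(_ k)]|x xW].
    by rewrite !in_set xW => <-.
  by apply/flatten_mapP; exists k; rewrite ?mem_enum // mem_cat xW orbT.
by rewrite (eq_eval_normal_form _ WE) (eq_eval_normal_form _ W'E) validV.
Qed.

Lemma finitely_based_of_representatives : finitely_based AA.
Proof.
apply: (@finitely_based_of_finite_family S AA candidate_index candidate).
move=> B modB [s t] Ast v /=.
have [g [W gW]] := term_normal_form s.
have [g' [W' gW']] := term_normal_form t.
have modA : model AA by [].
rewrite (gW B) // (gW' B) //; apply: normal_forms_eq => // w.
by rewrite -(gW AA) // -(gW' AA).
Qed.

End Basis.

Theorem corollary5p2 (F : finType) (ar : F -> nat) (A : finType)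
    (opA : forall f : F, (A ^ ar f)%type -> A) :
  (exists m : A -> A -> A,
     @is_compatible_semilattice_term_operation
       (Signature ar) (@Algebra (Signature ar) A opA) m) ->
  finitely_based (@Algebra (Signature ar) A opA).
Proof.
move=> [m [[tm mE] mxx mC mA m_hom]].
have [rep repP] :=
  @exists_representatives (Signature ar) A opA (variable_type A) set0.
apply: (@finitely_based_of_representatives F ar A opA tm) repP.
  by split=> [x|x y|x y z]; rewrite /binop -!mE.
move=> f x; rewrite [LHS](_ : _ = m (op x).1 (op x).2); last by rewrite mE.
by rewrite (m_hom f x); apply: congr1; apply/ffunP=> i; rewrite !ffunE mE.
Qed.
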